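(* There are constants $c_1>c_2>0$ such that for every fixed $d\geq 1$, almost surely the random graph $G(n,d/n)$ is $c_1d^2$-arrangeable but not $c_2d^2$-arrangeable.
   Context: $G(n,p)$ is the random graph on $n$ labeled vertices in which each edge appears independently with probability $p$. A property holds almost surely (a.s.) if its probability tends to $1$ as $n\to\infty$. A graph is $p$-arrangeable if there is an ordering $v_1,\ldots,v_n$ of its vertices such that for every vertex $v_i$, the neighbors of $v_i$ to the right of $v_i$ (i.e. $v_j$ with $j>i$) have together at most $p$ neighbors to the left of $v_i$, including $v_i$ (i.e. among $v_1,\ldots,v_i$). *)

(* Defs.v *)
From HB Require Import structures.
From mathcomp Require Import all_boot all_order all_algebra all_fingroup.

Set Implicit Arguments.
Unset Strict Implicit.
Unset Printing Implicit Defensive.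

Import Order.TTheory GRing.Theory Num.Theory.
Local Open Scope ring_scope.

(* The edges of a simple graph on V are two-element subsets of V. *)
Record sgraph (V : finType) := SGraph {
  edges : {set {set V}};
  edgesP : [forall e in edges, #|e| == 2]
}.

HB.instance Definition _ (V : finType) := [isSub for @edges V].
HB.instance Definition _ (V : finType) := [Finite of sgraph V by <:].

(* Irreflexive because [set x; x] is a singleton. *)
Definition adj (V : finType) (G : sgraph V) : rel V :=
  fun x y => [set x; y] \in edges G.

(* For the ordering v_i = s i of the vertices: the positions j <= i such that
   v_j is a neighbor of some neighbor v_k of v_i with k > i. Position i itself
   is counted whenever such a v_k exists. *)
Definition left_nbrs (n : nat) (G : sgraph 'I_n) (s : 'S_n) (i : 'I_n) :
    {set 'I_n} :=
  [set j : 'I_n | (j <= i)%N &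
    [exists k : 'I_n, [&& (i < k)%N, adj G (s i) (s k) & adj G (s k) (s j)]]].

(* The bound p may be any real number, so that c * d ^+ 2 is allowed. *)
Definition arrangeable (R : realDomainType) (n : nat) (p : R)
    (G : sgraph 'I_n) : bool :=
  [exists s : 'S_n, [forall i : 'I_n, #|left_nbrs G s i|%:R <= p]].

(* Each of the 'C(n, 2) potential edges is independently present with
   probability p. *)
Definition gnp_mass (R : realDomainType) (n : nat) (p : R)
    (G : sgraph 'I_n) : R :=
  \prod_(e : {set 'I_n} | #|e| == 2) (if e \in edges G then p else 1 - p).

(* Probability that G(n, p) satisfies A. It is a genuine probability when
   0 <= p <= 1; with p = d / n this holds for all n >= d with n > 0, hence for
   all but finitely many n. *)
Definition gnp_prob (R : realDomainType) (n : nat) (p : R)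
    (A : pred (sgraph 'I_n)) : R :=
  \sum_(G : sgraph 'I_n | A G) gnp_mass p G.

(* Main.v *)
(* Upper bound. Build the ordering from the right, removing from the set S of
   remaining vertices a vertex with at most B = K d neighbors in S; then every
   removed vertex has at most B neighbors in S. If S is larger than e^-10 n / d^3,
   it contains a vertex v of degree at most B, which has at most B^2 neighbors of
   neighbors in S via removed vertices. If S is smaller, the sets of size 4|S| span
   few edges, so the set T of removed vertices with two or more neighbors in S has
   size below 3|S|, and some vertex of S has fewer than 12 neighbors in S and T.

   Lower bound. Take the first, second and remaining n/5-blocks A, B, C of an
   ordering. For large d, almost surely any two disjoint sets of n/5 vertices are
   joined by many edges, so there are at least c d^2 n paths B - C - A; as there are
   few 4-cycles, they join about as many distinct pairs in B x A, whence some
   vertex of B reaches c d^2 vertices of A through C. For bounded d the constant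
   c_2 makes the bound less than 1 and one edge suffices.

   Every random event is a union bound over exponential moments of the number of
   edges in a fixed set of pairs. *)

Require Import Defs.
From mathcomp Require Import all_boot all_order all_algebra all_fingroup.
From mathcomp Require Import all_classical all_reals all_analysis.
From mathcomp Require Import fintype finset ring lra zify.

Set Implicit Arguments.
Unset Strict Implicit.
Unset Printing Implicit Defensive.

Import Order.TTheory GRing.Theory Num.Theory.
Import numFieldNormedType.Exports.
Local Open Scope ring_scope.

(** * Exponential moments and tail bounds in G(n, p) *)

Section GnpMoments.
Variables (R : realType) (n : nat).
Implicit Types (p z : R) (F : {set {set 'I_n}}) (A : pred (sgraph 'I_n)).

Lemma edge_card2 (G : sgraph 'I_n) e : e \in edges G -> #|e| = 2%N.
Proof. by move=> eG; have /forallP/(_ e)/implyP/(_ eG)/eqP := edgesP G. Qed.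

(** Independence of the edges: expanding the product on the right chooses presence or absence for
    every pair, and each choice is one graph. *)
Lemma sum_sgraph_prod (a b : {set 'I_n} -> R) :
  \sum_(G : sgraph 'I_n)
     \prod_(e : {set 'I_n} | #|e| == 2) (if e \in edges G then a e else b e) =
  \prod_(e : {set 'I_n} | #|e| == 2) (a e + b e).
Proof.
(* The values 0 and 1 off the two-element sets kill every family that is not an edge set and
   otherwise contribute only factors 1. *)
pose a' (e : {set 'I_n}) : R := if #|e| == 2 then a e else 0.
pose b' (e : {set 'I_n}) : R := if #|e| == 2 then b e else 1.
transitivity (\prod_e (a' e + b' e)); last first.
  rewrite [RHS]big_mkcond; apply: eq_bigr => e _.
  by rewrite /a' /b'; case: ifP => // _; rewrite add0r.
rewrite bigA_distr.
rewrite (bigID (fun J : {set {set 'I_n}} => [forall e in J, #|e| == 2])) /=.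
rewrite [X in _ = _ + X]big1 ?addr0 => [|J]; last first.
  case/forallPn => e; rewrite negb_imply => /andP[eJ /negbTE ne].
  by rewrite (bigD1 e) //= eJ /a' ne mul0r.
have P0 : [forall e in (set0 : {set {set 'I_n}}), #|e| == 2].
  by apply/forall_inP => e; rewrite in_set0.
pose h (J : {set {set 'I_n}}) : sgraph 'I_n := insubd (SGraph P0) J.
rewrite (reindex_onto (@edges 'I_n) h) /=; last first.
  by move=> J PJ; have := val_insubd (SGraph P0) J; rewrite /= PJ.
apply: eq_big => [G|G _].
  by rewrite edgesP; symmetry; apply/eqP/val_inj; rewrite /h val_insubd edgesP.
rewrite big_mkcond; apply: eq_bigr => e _; rewrite /a' /b'.
case: ifP => //= ne; case: ifP => // /edge_card2/eqP; by rewrite ne.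
Qed.

Lemma gnp_mass_ge0 p (G : sgraph 'I_n) : 0 <= p <= 1 -> 0 <= gnp_mass p G.
Proof.
move=> /andP[p0 p1]; apply: prodr_ge0 => e _; case: ifP => // _.
by rewrite subr_ge0.
Qed.

Lemma gnp_probT p : gnp_prob p (fun _ : sgraph 'I_n => true) = 1.
Proof.
rewrite /gnp_prob /gnp_mass (sum_sgraph_prod (fun=> p) (fun=> 1 - p)).
by apply: big1 => e _; rewrite subrKC.
Qed.

Lemma gnp_prob_predC p A : gnp_prob p A = 1 - gnp_prob p (fun G => ~~ A G).
Proof. by rewrite -(gnp_probT p) /gnp_prob [in RHS](bigID A) /= addrK. Qed.

Lemma gnp_prob_ge0 p A : 0 <= p <= 1 -> 0 <= gnp_prob p A.
Proof. by move=> p01; apply: sumr_ge0 => G _; apply: gnp_mass_ge0. Qed.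

Lemma gnp_markov p A (f : sgraph 'I_n -> R) : 0 <= p <= 1 ->
  (forall G, 0 <= f G) -> (forall G, A G -> 1 <= f G) ->
  gnp_prob p A <= \sum_G gnp_mass p G * f G.
Proof.
move=> p01 f0 f1; rewrite [leRHS](bigID A) /= -[leLHS]addr0; apply: lerD.
  by apply: ler_sum => G AG; rewrite ler_peMr ?gnp_mass_ge0 ?f1.
by apply: sumr_ge0 => G _; rewrite mulr_ge0 ?gnp_mass_ge0.
Qed.

Lemma gnp_union (I : finType) (P : pred I) p A (B : I -> pred (sgraph 'I_n)) :
  0 <= p <= 1 -> (forall G, A G -> exists2 i, P i & B i G) ->
  gnp_prob p A <= \sum_(i | P i) gnp_prob p (B i).
Proof.
move=> p01 AB.
pose f (G : sgraph 'I_n) : R := \sum_(i | P i) (B i G)%:R.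
apply: le_trans (gnp_markov (f := f) p01 _ _) _.
- by move=> G; apply: sumr_ge0 => i _.
- move=> G /AB[i Pi BiG]; rewrite /f (bigD1 i) //= BiG lerDl.
  by apply: sumr_ge0.
under eq_bigr do rewrite mulr_sumr.
rewrite exchange_big /= le_eqVlt; apply/orP; left; apply/eqP/eq_bigr => i _.
rewrite /gnp_prob [RHS]big_mkcond; apply: eq_bigr => G _.
by case: ifP; rewrite ?mulr1 ?mulr0.
Qed.

Lemma gnp_mean_exp p z F : 0 <= p <= 1 -> 0 <= z ->
  {in F, forall e : {set 'I_n}, #|e| = 2%N} ->
  \sum_(G : sgraph 'I_n) gnp_mass p G * z ^+ #|edges G :&: F| =
  (1 + p * (z - 1)) ^+ #|F|.
Proof.
move=> p01 z0 F2.
transitivity (\sum_(G : sgraph 'I_n) \prod_(e : {set 'I_n} | #|e| == 2)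
   (if e \in edges G then (if e \in F then p * z else p) else 1 - p)).
  apply: eq_bigr => G _; rewrite /gnp_mass.
  have -> : z ^+ #|edges G :&: F| = \prod_(e : {set 'I_n} | #|e| == 2)
      (if (e \in edges G) && (e \in F) then z else 1).
    rewrite -prodr_const big_mkcond [RHS]big_mkcond; apply: eq_bigr => e _.
    rewrite in_setI; case: andP => [[eG _]|_]; last by case: ifP.
    by rewrite (edge_card2 eG).
  rewrite -big_split /=; apply: eq_bigr => e _.
  by case: (e \in edges G); case: (e \in F); rewrite ?mulr1.
rewrite (sum_sgraph_prod (fun e => if e \in F then p * z else p) (fun=> 1 - p)).
rewrite -prodr_const big_mkcond [RHS]big_mkcond; apply: eq_bigr => e _.
case: (boolP (e \in F)) => [/F2 ->|_] /=; first by ring.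
by case: ifP => // _; rewrite subrKC.
Qed.

(** Follows from [1 + x <= e^x]. Comparing products with [z - 1] lets [m] bound [#|F|] from above
    when [1 <= z] and from below when [z <= 1]. *)
Lemma gnp_mean_exp_le p z F m : 0 <= p <= 1 -> 0 <= z ->
  {in F, forall e : {set 'I_n}, #|e| = 2%N} ->
  p * m * (z - 1) >= p * #|F|%:R * (z - 1) ->
  \sum_(G : sgraph 'I_n) gnp_mass p G * z ^+ #|edges G :&: F| <=
  expR (p * m * (z - 1)).
Proof.
move=> p01 z0 F2 Fm; rewrite gnp_mean_exp //.
have /andP[p0 p1] := p01.
apply: le_trans (_ : expR (p * (z - 1)) ^+ #|F| <= _).
  apply: lerXn2r; rewrite ?nnegrE ?expR_ge0 ?expR_ge1Dx //; nra.
by rewrite -expRM_natl ler_expR mulrCA mulrA.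
Qed.

(** Chernoff's bound with a free base [z], later taken as [e^2], [n / (d s)] and [1 / p]. *)
Lemma gnp_upper_tail p z F (m : R) k A : 0 <= p <= 1 -> 1 <= z ->
  {in F, forall e : {set 'I_n}, #|e| = 2%N} -> #|F|%:R <= m ->
  (forall G, A G -> (k <= #|edges G :&: F|)%N) ->
  gnp_prob p A <= expR (p * m * (z - 1)) / z ^+ k.
Proof.
move=> p01 z1 F2 Fm Ak; have /andP[p0 p1] := p01.
have zk : 0 < z ^+ k by rewrite exprn_gt0 //; lra.
apply: le_trans (gnp_markov
  (f := fun G => z ^+ #|edges G :&: F| / z ^+ k) p01 _ _) _.
- by move=> G; rewrite divr_ge0 ?exprn_ge0 //; lra.
- by move=> G /Ak kG; rewrite ler_pdivlMr // mul1r ler_weXn2l.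
under eq_bigr do rewrite mulrA.
rewrite -mulr_suml ler_pM2r ?invr_gt0 //.
apply: gnp_mean_exp_le => //; first by lra.
by apply: ler_wpM2r; [rewrite subr_ge0 | apply: ler_wpM2l].
Qed.

(** Chernoff's bound with base [z = 1 / e], where [z - 1 <= - 1 / 2]. *)
Lemma gnp_lower_tail p F (m x : R) A : 0 <= p <= 1 ->
  {in F, forall e : {set 'I_n}, #|e| = 2%N} -> m <= #|F|%:R ->
  (forall G, A G -> #|edges G :&: F|%:R <= x) ->
  gnp_prob p A <= expR (x - p * m / 2).
Proof.
move=> p01 F2 Fm Ax; have /andP[p0 p1] := p01.
have e2 : expR (- 1) <= 1 / 2 :> R.
  rewrite expRN div1r lef_pV2 ?posrE ?expR_gt0 ?ltr0n //.
  by apply: le_trans (expR_ge1Dx 1).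
have e0 := expR_ge0 (- 1 : R).
apply: le_trans (gnp_markov
  (f := fun G => expR (- 1) ^+ #|edges G :&: F| * expR x) p01 _ _) _.
- by move=> G; rewrite mulr_ge0 ?exprn_ge0 ?expR_ge0.
- by move=> G /Ax kx; rewrite -expRM_natl -expRD -[leLHS]expR0 ler_expR mulrN1 addrC subr_ge0.
under eq_bigr do rewrite mulrA.
rewrite -mulr_suml expRD mulrC ler_pM2l ?expR_gt0 //.
apply: le_trans (gnp_mean_exp_le (m := #|F|%:R) _ _ _ _) _ => //.
rewrite ler_expR.
have : p * m <= p * #|F|%:R by rewrite ler_wpM2l.
have : 0 <= p * #|F|%:R by rewrite mulr_ge0.
nra.
Qed.

(** ['C(N, k) * x ^+ k] is one term of [(1 + x) ^+ N]. With [x = k / N] this is the usual bound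
    [(e N / k)^k]. *)
Lemma bin_le_exp (N k : nat) (x : R) : 0 < x ->
  'C(N, k)%:R <= expR (x * N%:R) / x ^+ k.
Proof.
move=> x0; rewrite ler_pdivlMr ?exprn_gt0 //.
apply: le_trans (_ : (1 + x) ^+ N <= _); last first.
  by rewrite expRM_natr lerXn2r ?nnegrE ?expR_ge0 ?expR_ge1Dx //; lra.
have [kN|Nk] := leqP k N; last first.
  by rewrite bin_small // mul0r exprn_ge0 //; lra.
have {}kN : (k < N.+1)%N by [].
rewrite exprDn (bigD1 (Ordinal kN)) //= expr1n mul1r mulr_natl lerDl.
by apply: sumr_ge0 => i _; rewrite mulrn_wge0 // mulr_ge0 ?expr1n ?exprn_ge0 ?ltW.
Qed.

End GnpMoments.

(** * Neighborhoods and greedy orderings *)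

Section Neighborhoods.
Variable (V : finType).
Implicit Types (G : sgraph V) (X Y S W : {set V}) (D : {set V * V}).

Definition nbrs G x := [set y | adj G x y].

(** Ordered pairs are counted, so an edge inside both sets counts twice. *)
Definition vol G X Y := (\sum_(x in X) #|nbrs G x :&: Y|)%N.

Definition pair_edges D : {set {set V}} :=
  [set [set x.1; x.2] | x in D & x.1 != x.2].

Lemma adjC G x y : adj G x y = adj G y x.
Proof. by rewrite /adj setUC. Qed.

Lemma adj_neq G x y : adj G x y -> x != y.
Proof.
have /forallP/(_ [set x; y])/implyP h := edgesP G.
by move=> /h; apply: contraTneq => ->; rewrite setUid cards1.
Qed.

Lemma volE G X Y : vol G X Y = (\sum_(x in X) \sum_(y in Y) adj G x y)%N.
Proof.
apply: eq_bigr => x _; rewrite -sum1_card big_mkcond [RHS]big_mkcond.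
by apply: eq_bigr => y _; rewrite !inE; case: (adj G x y); case: (y \in Y).
Qed.

Lemma volC G X Y : vol G X Y = vol G Y X.
Proof.
by rewrite !volE exchange_big; apply: eq_bigr => x _; apply: eq_bigr => y _;
   rewrite adjC.
Qed.

Lemma vol_card G X Y :
  vol G X Y = #|[set z in setX X Y | adj G z.1 z.2]|.
Proof.
rewrite volE pair_big_dep /= -sum1_card [RHS]big_mkcond [LHS]big_mkcond.
apply: eq_bigr => -[x y] _ /=; rewrite !inE /=.
by case: (adj G x y); case: (_ && _).
Qed.

Lemma pair_edges_card2 D : {in pair_edges D, forall e : {set V}, #|e| = 2%N}.
Proof. by move=> e /imsetP[x]; rewrite inE => /andP[_ nx] ->; rewrite cards2 nx. Qed.

Lemma card_pair_edges D : (#|pair_edges D| <= #|D|)%N.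
Proof.
apply: leq_trans (leq_imset_card _ _) _; apply: subset_leq_card.
by apply/subsetP => x; rewrite inE => /andP[].
Qed.

Lemma set2_eq (a b c d : V) :
  [set a; b] = [set c; d] -> (a = c /\ b = d) \/ (a = d /\ b = c).
Proof.
move=> /setP e.
move: (e a) (e b) (e c) (e d); rewrite !inE !eqxx ?orbT /=.
case/esym/orP => /eqP ea; case/esym/orP => /eqP eb; subst; auto.
- by rewrite !orbb => _ /eqP ->; left.
- by rewrite !orbb => /eqP -> _; left.
Qed.

(* Every edge comes from at most two ordered pairs. *)
Lemma vol_le_edges G X Y :
  (vol G X Y <= 2 * #|edges G :&: pair_edges (setX X Y)|)%N.
Proof.
rewrite vol_card.
set Z := [set z in _ | _]; pose h (z : V * V) := [set z.1; z.2].
rewrite -sum1_card (partition_big_imset h) /=.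
apply: leq_trans (_ : \sum_(e in h @: Z) 2 <= _)%N; last first.
  rewrite sum_nat_const mulnC leq_mul2l /=; apply: subset_leq_card.
  apply/subsetP => e /imsetP[z]; rewrite !inE => /andP[zXY az] ->.
  rewrite [_ \in edges G]az /=; apply/imsetP; exists z => //.
  by rewrite !inE zXY (adj_neq az).
apply: leq_sum => e /imsetP[z zZ ->].
rewrite sum1dep_card.
apply: leq_trans (_ : #|[set z; (z.2, z.1)]| <= _)%N; last first.
  by rewrite cards2; case: eqP.
apply: subset_leq_card; apply/subsetP => -[a b]; rewrite !inE => /andP[_ /eqP].
case: z zZ => c d _ /set2_eq /= [] [-> ->]; rewrite ?eqxx ?orbT //.
Qed.

Lemma edges_le_vol G X Y :
  (#|edges G :&: pair_edges (setX X Y)| <= vol G X Y)%N.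
Proof.
rewrite vol_card.
apply: leq_trans (leq_imset_card (fun z : V * V => [set z.1; z.2]) _).
apply: subset_leq_card; apply/subsetP => e; rewrite inE => /andP[eG].
case/imsetP => z; rewrite inE => /andP[zXY _] ez.
by apply/imsetP; exists z => //; rewrite inE zXY /adj -ez.
Qed.

Lemma card_pair_edges_disjoint X Y : [disjoint X & Y] ->
  #|pair_edges (setX X Y)| = (#|X| * #|Y|)%N.
Proof.
move=> dXY; have dis z : z \in X -> z \in Y -> false.
  by move=> zX zY; move/pred0P/(_ z): dXY; rewrite /= zX zY.
rewrite /pair_edges -cardsX card_in_imset.
  congr #|pred_of_set _|; apply/setP => -[a b]; rewrite !inE /= andbC.
  by apply/andb_idl => /andP[aX bY]; apply: contraTneq bY => <-; apply/negP => /(dis _ aX).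
move=> [a b] [c d]; rewrite !inE /= => /andP[/andP[aX bY] _] /andP[/andP[cX dY] _].
by case/set2_eq => -[ac bd]; subst => //; have := dis _ aX dY.
Qed.

Lemma volS G X Y X' Y' : X \subset X' -> Y \subset Y' ->
  (vol G X Y <= vol G X' Y')%N.
Proof.
move=> XX YY; rewrite !vol_card; apply/subset_leq_card/subsetP => z.
rewrite !inE -!andbA => /and3P[zX zY ->].
by rewrite (subsetP XX) // (subsetP YY).
Qed.

End Neighborhoods.

(** * Greedy orderings built from the right *)

Section GreedyOrdering.
Variable (V : finType).
Implicit Types (G : sgraph V) (S T W : {set V}).

(** When [S] is an initial segment of an ordering ending in [v], this is the set whose size
    arrangeability bounds. *)
Definition back_nbrs G S v :=
  [set w in S | [exists u, [&& u \notin S, adj G v u & adj G u w]]].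

(** The chosen vertex goes to the right end of the list and leaves [S]. The invariant survives:
    neighborhoods in [S] only shrink, and the new outside vertex has at most [B] neighbors in [S] by
    its choice. *)
Lemma greedy_ordering G (B P : nat) :
  (forall S, S != set0 -> (forall u, u \notin S -> (#|nbrs G u :&: S| <= B)%N) ->
     exists2 v, v \in S &
       (#|nbrs G v :&: S| <= B)%N /\ (#|back_nbrs G S v| <= P)%N) ->
  exists l : seq V, [/\ uniq l, l =i [set: V] &
    forall x0 i, (i < size l)%N ->
      (#|back_nbrs G [set x in take i.+1 l] (nth x0 l i)| <= P)%N].
Proof.
move=> step.
suff gen m S : #|S| = m ->
    (forall u, u \notin S -> (#|nbrs G u :&: S| <= B)%N) ->
    exists l : seq V, [/\ uniq l, l =i S &
      forall x0 i, (i < size l)%N ->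
        (#|back_nbrs G [set x in take i.+1 l] (nth x0 l i)| <= P)%N].
  by apply: (gen _ [set: V] erefl) => u; rewrite inE.
elim: m S => [|m IH] S Sm inv.
  exists [::]; split=> // x; move/eqP: Sm; rewrite cards_eq0 => /eqP ->.
  by rewrite !inE.
have S0 : S != set0 by rewrite -card_gt0 Sm.
have [v vS [vB vP]] := step S S0 inv.
have [||l [ul lS lP]] := IH (S :\ v).
- by apply/eqP; rewrite -eqSS -Sm (cardsD1 v S) vS.
- move=> u; rewrite !inE negb_and negbK => /orP[/eqP ->|uS].
    by apply: leq_trans vB; rewrite subset_leq_card // setIS // subsetDl.
  by apply: leq_trans (inv u uS); rewrite subset_leq_card // setIS // subsetDl.
exists (rcons l v); split.
- by rewrite rcons_uniq ul lS !inE eqxx.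
- by move=> x; rewrite mem_rcons inE lS !inE; case: eqVneq => // ->.
move=> x0 i; rewrite size_rcons ltnS leq_eqVlt => /orP[/eqP ->|il].
  rewrite nth_rcons ltnn eqxx take_oversize ?size_rcons //.
  suff -> : [set x in rcons l v] = S by [].
  by apply/setP => x; rewrite inE mem_rcons inE lS !inE; case: eqVneq => // ->.
by rewrite nth_rcons il -cats1 takel_cat //; apply: lP.
Qed.

Lemma card_back_nbrs_le G S v :
  (#|back_nbrs G S v| <= \sum_(u in nbrs G v | u \notin S) #|nbrs G u :&: S|)%N.
Proof.
apply: leq_trans (_ : #|\bigcup_(u in nbrs G v | u \notin S) (nbrs G u :&: S)| <= _)%N.
  apply/subset_leq_card/subsetP => w; rewrite inE => /andP[wS /existsP[u]].
  case/and3P => uS vu uw; apply/bigcupP; exists u; rewrite ?inE ?vu ?uS //.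
  by rewrite uw wS.
elim/big_rec2: _ => [|u m X _ h]; first by rewrite cards0.
by apply: leq_trans (leq_card_setU _ _) _; rewrite leq_add2l.
Qed.

Lemma subset_of_card (T : finType) (A : {set T}) k : (k <= #|A|)%N ->
  exists2 X : {set T}, X \subset A & #|X| = k.
Proof.
move=> kA; have : (0 < #|[set X : {set T} | X \subset A & #|X| == k]|)%N.
  by rewrite cards_draws bin_gt0.
by case/card_gt0P => X; rewrite inE => /andP[XA /eqP Xk]; exists X.
Qed.

Lemma superset_of_card (A : {set V}) k : (#|A| <= k <= #|V|)%N ->
  exists2 X : {set V}, A \subset X & #|X| = k.
Proof.
move=> /andP[Ak kV]; have [|X XA Xk] := @subset_of_card _ (~: A) (#|V| - k)%N.
  by have := cardsC A; lia.
exists (~: X); first by rewrite -[A]setCK setCS.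
by have := cardsC X; lia.
Qed.

(* Below the threshold [s0] the vertices of [S] and the outside vertices [T]
   seeing at least two of them span few edges, so some vertex of [S] has bounded
   degree into [S :|: T]; its other outside neighbors see no vertex of [S] but
   itself. *)
Lemma greedy_step G (B s0 : nat) : (12 <= B)%N -> (4 * s0 <= #|V|)%N ->
  (forall S, (s0 < #|S|)%N -> exists2 v, v \in S & (#|nbrs G v| <= B)%N) ->
  (forall W s, (0 < s <= s0)%N -> #|W| = (4 * s)%N -> (vol G W W < 12 * s)%N) ->
  forall S, S != set0 -> (forall u, u \notin S -> (#|nbrs G u :&: S| <= B)%N) ->
     exists2 v, v \in S &
       (#|nbrs G v :&: S| <= B)%N /\ (#|back_nbrs G S v| <= B * B)%N.
Proof.
move=> B12 s0V large small S S0 inv; set s := #|S|.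
have s_gt0 : (0 < s)%N by rewrite card_gt0.
have [ls|sl] := ltnP s0 s.
  have [v vS vB] := large S ls; exists v => //; split.
    by apply: leq_trans vB; apply/subset_leq_card/subsetIl.
  apply: leq_trans (card_back_nbrs_le _ _ _) _.
  apply: leq_trans (_ : \sum_(u in nbrs G v) B <= _)%N; last first.
    by rewrite sum_nat_const leq_mul2r vB orbT.
  rewrite big_mkcondr; apply: leq_sum => u _.
  by case: ifP => // /inv.
pose T := [set u | u \notin S & (2 <= #|nbrs G u :&: S|)%N].
have dST (U : {set V}) : U \subset T -> [disjoint S & U].
  move=> UT; rewrite disjoint_sym disjoints_subset; apply: subset_trans UT _.
  by apply/subsetP => u; rewrite !inE => /andP[].
have volT (U : {set V}) : U \subset T -> (2 * #|U| <= vol G U S)%N.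
  move=> UT; rewrite mulnC -sum_nat_const; apply: leq_sum => u /(subsetP UT).
  by rewrite inE => /andP[].
have cardST (U : {set V}) : U \subset T -> #|S :|: U| = (s + #|U|)%N.
  by move=> UT; rewrite cardsU (disjoint_setI0 (dST _ UT)) cards0 subn0.
(* Otherwise [3 * s] vertices of [T] together with [S] form a set of size [4 * s]; each sends two
   edges into [S], and counting these from both ends gives volume [12 * s]. *)
have T_lt : (#|T| < 3 * s)%N.
  rewrite ltnNge; apply/negP => /subset_of_card[U UT Us].
  have := small (S :|: U) s; rewrite s_gt0 sl cardST // Us => /(_ isT).
  have <- : (4 * s = s + 3 * s)%N by lia.
  move=> /(_ erefl); rewrite ltnNge; apply/negP; rewrite negbK.
  apply: leq_trans (_ : vol G S U + vol G U S <= _)%N.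
    by rewrite volC; have := volT U UT; rewrite Us; lia.
  rewrite [leqRHS](_ : _ = \sum_(x in [predU S & U]) #|nbrs G x :&: (S :|: U)|)%N;
    last by apply: eq_bigl => x; rewrite !inE.
  rewrite bigU ?dST //=.
  by apply: leq_add; apply: leq_sum => u _; apply/subset_leq_card/setIS;
     [apply: subsetUr | apply: subsetUl].
(* [S :|: T] has fewer than [4 * s] vertices and is padded to that size, so the average degree from
   [S] into it is below 12. *)
have volST : (vol G S (S :|: T) < 12 * s)%N.
  have [|W STW Ws] := @superset_of_card (S :|: T) (4 * s)%N.
    by rewrite cardST //; lia.
  apply: leq_ltn_trans (small W s _ Ws); last by rewrite s_gt0.
  by apply: volS => //; apply: subset_trans STW; apply: subsetUl.
have [v vS v12] : exists2 v, v \in S & (#|nbrs G v :&: (S :|: T)| < 12)%N.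
  apply/exists_inP; apply: contraLR volST.
  rewrite negb_exists_in => /forall_inP h; rewrite -leqNgt mulnC -sum_nat_const.
  by apply: leq_sum => v /h; rewrite -leqNgt.
exists v => //; split.
  apply: leq_trans (_ : _ <= 12)%N B12; apply: leq_trans (ltnW v12).
  by apply/subset_leq_card/setIS/subsetUl.
apply: leq_trans (_ : 1 + \sum_(u in nbrs G v :&: T) #|nbrs G u :&: S| <= _)%N.
  apply: leq_trans (_ : #|[set v] :|: \bigcup_(u in nbrs G v :&: T) (nbrs G u :&: S)| <= _)%N.
    apply/subset_leq_card/subsetP => w; rewrite inE => /andP[wS /existsP[u]].
    case/and3P => uS vu uw; rewrite !inE.
    case: eqVneq => //= wv; apply/bigcupP; exists u; last by rewrite !inE uw wS.
    rewrite !inE vu uS /=.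
    apply: leq_trans (_ : #|[set v; w]| <= _)%N; first by rewrite cards2 eq_sym wv.
    apply/subset_leq_card/subsetP => x; rewrite !inE => /orP[]/eqP ->.
      by rewrite adjC vu.
    by rewrite uw.
  apply: leq_trans (leq_card_setU _ _) _; rewrite cards1 leq_add2l.
  elim/big_rec2: _ => [|u m X _ h]; first by rewrite cards0.
  by apply: leq_trans (leq_card_setU _ _) _; rewrite leq_add2l.
apply: leq_trans (_ : 1 + \sum_(u in nbrs G v :&: T) B <= _)%N.
  rewrite leq_add2l; apply: leq_sum => u; rewrite !inE => /and3P[_ uS _].
  exact: inv.
rewrite sum_nat_const.
(* The total [1 + 11 * B] is at most [B * B] because [12 <= B]. *)
have : (#|nbrs G v :&: T| <= 11)%N.
  rewrite -ltnS; apply: leq_ltn_trans v12.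
  by apply/subset_leq_card/setIS/subsetUr.
nia.
Qed.

End GreedyOrdering.

Lemma arrangeable_of_greedy (R : realDomainType) n (G : sgraph 'I_n)
    (B P : nat) (p : R) : P%:R <= p ->
  (forall S, S != set0 -> (forall u, u \notin S -> (#|nbrs G u :&: S| <= B)%N) ->
     exists2 v, v \in S &
       (#|nbrs G v :&: S| <= B)%N /\ (#|back_nbrs G S v| <= P)%N) ->
  arrangeable p G.
Proof.
move=> Pp /greedy_ordering[l [ul lT lP]].
have sl : size l = n.
  rewrite -(card_uniqP ul) -[RHS](card_ord n) -cardsT; exact: eq_card.
have sinj : injective (fun i : 'I_n => nth i l i).
  move=> i j; rewrite (set_nth_default j) ?sl // => /eqP.
  by rewrite nth_uniq ?sl // => /eqP/val_inj.
apply/existsP; exists (perm sinj); apply/forallP => i.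
apply: le_trans Pp; rewrite ler_nat.
have := lP i i; rewrite sl => /(_ (ltn_ord i)); apply: leq_trans.
(* [left_nbrs] consists of positions and [back_nbrs] of vertices, so the former is mapped through
   the ordering. *)
rewrite -(card_imset _ (@perm_inj _ (perm sinj))); apply: subset_leq_card.
have seen (j : 'I_n) : (perm sinj j \in take i.+1 l) = (j <= i)%N.
  rewrite permE -[RHS]ltnS in_take ?mem_nth ?sl //.
  by rewrite index_uniq ?sl.
apply/subsetP => x /imsetP[j]; rewrite inE => /andP[ji /existsP[k]].
case/and3P => ik ak1 ak2 {x}->; rewrite !inE seen ji /=.
apply/existsP; exists (perm sinj k); rewrite inE seen -ltnNge ik ak2 andbT /=.
by move: ak1; rewrite [perm sinj i]permE.
Qed.

(** * Counting cherries between blocks of an ordering *)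

Section LowerBound.
Variable (R : realDomainType).

(** The left end of an edge reaches itself through the right end, so its count is at least 1. *)
Lemma not_arrangeable_edge n (G : sgraph 'I_n) (p : R) (x y : 'I_n) :
  adj G x y -> p < 1 -> ~~ arrangeable p G.
Proof.
move=> xy p1; apply/existsPn => s; apply/forallPn.
have pos z : s (s^-1%g z) = z by rewrite permKV.
wlog lt_xy : x y xy / (s^-1%g x < s^-1%g y)%N => [th|].
  have [h|h|/val_inj/perm_inj h] := ltngtP (s^-1%g x) (s^-1%g y).
  - exact: th h.
  - by apply: th h; rewrite adjC.
  - by move: (adj_neq xy); rewrite h eqxx.
exists (s^-1%g x); rewrite -ltNge; apply: lt_le_trans p1 _.
rewrite -[1]/(1%:R) ler_nat card_gt0; apply/set0Pn; exists (s^-1%g x).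
rewrite inE leqnn; apply/existsP; exists (s^-1%g y).
by rewrite lt_xy !pos xy adjC.
Qed.

(* Ordered count: [v - u - w - u' - v], with opposite corners [v], [w]. *)
Definition c4_count (V : finType) (G : sgraph V) : nat :=
  (\sum_v \sum_w \sum_u \sum_u'
     [&& v != w, u != u', adj G v u, adj G u w, adj G v u' & adj G u' w])%N.

(** With one element of [U] fixed in first place, the pairs of distinct elements already number
    [#|U| - 1]. *)
Lemma card_le_pairs (V : finType) (U : {set V}) :
  (#|U| <= (U != set0) + \sum_(u in U) \sum_(u' in U) (u != u'))%N.
Proof.
have [->|/set0Pn[u uU]] := eqVneq U set0; first by rewrite cards0.
rewrite (bigD1 u) //= (cardsD1 u) uU leq_add2l; apply: leq_trans (leq_addr _ _).
rewrite -sum1_card big_mkcond [leqRHS]big_mkcond; apply: leq_sum => v _.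
by rewrite !inE eq_sym; case: eqVneq; case: (v \in U).
Qed.

(* A pair [(v, w)] with [k] common neighbors is overcounted [k - 1] times, which
   is at most the number of 4-cycles with opposite corners [v] and [w]. *)
Lemma cherries_le (V : finType) (G : sgraph V) (A B C : {set V}) :
  [disjoint A & B] ->
  (\sum_(u in C) #|nbrs G u :&: A| * #|nbrs G u :&: B| <=
   \sum_(v in B) #|[set w in A | [exists u in C, adj G v u && adj G u w]]|
   + c4_count G)%N.
Proof.
move=> dAB.
(* The ends of a cherry differ by disjointness, as [c4_count] demands of opposite corners. *)
have vw v w : v \in B -> w \in A -> v != w.
  move=> vB wA; apply: contraTneq dAB => e; apply/negP => /pred0P/(_ w) /=.
  by rewrite wA -e vB.
pose U v w := [set u in C | adj G v u && adj G u w].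
(* Double counting: cherries are sorted by their two ends instead of their center. *)
apply: leq_trans (_ : \sum_(v in B) \sum_(w in A) #|U v w| <= _)%N.
  have -> : (\sum_(v in B) \sum_(w in A) #|U v w| =
      \sum_(u in C) \sum_(v in B) \sum_(w in A) (adj G v u && adj G u w))%N.
    rewrite [RHS]exchange_big; apply: eq_bigr => v _.
    rewrite [RHS]exchange_big; apply: eq_bigr => w _.
    rewrite -sum1_card big_mkcond [RHS]big_mkcond; apply: eq_bigr => u _.
    by rewrite inE; case: (u \in C) => //=; case: (_ && _).
  apply: leq_sum => u _.
  rewrite mulnC -!sum1_card big_distrlr /= big_mkcond [leqRHS]big_mkcond.
  apply: leq_sum => v _; rewrite !inE adjC.
  case: (v \in B); rewrite ?andbF // andbT.
  case: (adj G v u) => //=; rewrite big_mkcond [leqRHS]big_mkcond.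
  by apply: leq_sum => w _; rewrite !inE; case: (adj G u w); case: (w \in A).
apply: leq_trans (_ : \sum_(v in B) \sum_(w in A)
    ((U v w != set0) + \sum_(u in U v w) \sum_(u' in U v w) (u != u')) <= _)%N.
  by apply: leq_sum => v _; apply: leq_sum => w _; apply: card_le_pairs.
under eq_bigr do rewrite big_split /=.
rewrite big_split /=; apply: leq_add.
  apply: leq_sum => v _; rewrite -sum1_card big_mkcond [leqRHS]big_mkcond.
  apply: leq_sum => w _; rewrite !inE; case: (w \in A) => //=.
  case: set0Pn => // -[u]; rewrite inE => /andP[uC h].
  by case: exists_inP => // -[]; exists u.
rewrite big_mkcond; apply: leq_sum => v _; case: ifP => // vB.
rewrite big_mkcond; apply: leq_sum => w _; case: ifP => // wA.
rewrite big_mkcond; apply: leq_sum => u _; case: ifP => //.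
rewrite inE => /and3P[uC vu uw].
rewrite big_mkcond; apply: leq_sum => u' _; case: ifP => //.
rewrite inE => /and3P[u'C vu' u'w].
by rewrite vu uw vu' u'w (vw v w vB wA); case: (u != u').
Qed.

(* The middle block [B] of positions reaches the first block [A] through the
   last block; both blocks see most of the last block at least [t] times. *)
Lemma arrangeable_cherries n (G : sgraph 'I_n) (p t : R) (q : nat) :
  (0 < q)%N -> (5 * q <= n)%N -> 0 <= t ->
  (forall X Y : {set 'I_n}, #|X| = q -> #|Y| = q -> [disjoint X & Y] ->
     q%:R * t <= (vol G X Y)%:R) ->
  arrangeable p G -> q%:R * t ^+ 2 <= q%:R * p + (c4_count G)%:R.
Proof.
move=> q0 qn t0 exp /existsP[s /forallP sp].
pose r v : 'I_n := s^-1%g v.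
have rK v : s (r v) = v by rewrite permKV.
have block (P : pred 'I_n) : #|[set v | P (r v)]| = #|[set i | P i]|.
  rewrite -(card_imset [set v | P (r v)] (@perm_inj _ s^-1%g)).
  congr #|pred_of_set _|; apply/setP => i; apply/imsetP/idP; rewrite inE.
    by case=> v; rewrite inE => h ->.
  by move=> Pi; exists (s i); rewrite ?inE /r permK.
have interval a b : (a <= b <= n)%N -> #|[set i : 'I_n | a <= i < b]%N| = (b - a)%N.
  move=> /andP[ab bn]; rewrite -sum1dep_card.
  rewrite -(big_mkord (fun i => a <= i < b)%N (fun=> 1%N)).
  rewrite -[RHS]muln1 -sum_nat_const_nat [RHS](big_nat_widen _ _ n) //.
  by rewrite [RHS](big_nat_widenl _ 0%N) //; apply: eq_bigl => i; rewrite andbC.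
pose A := [set v | 0 <= r v < q]%N; pose B := [set v | q <= r v < 2 * q]%N.
pose C := [set v | 2 * q <= r v < n]%N.
have Aq : #|A| = q by rewrite (block (fun i => 0 <= i < q)%N) interval; lia.
have Bq : #|B| = q by rewrite (block (fun i => q <= i < 2 * q)%N) interval; lia.
have Cq : (3 * q <= #|C|)%N by rewrite (block (fun i => 2 * q <= i < n)%N) interval; lia.
have dA : [disjoint A & C].
  by apply/pred0P => v /=; rewrite !inE; apply/negP; lia.
have dB : [disjoint B & C].
  by apply/pred0P => v /=; rewrite !inE; apply/negP; lia.
have dAB : [disjoint A & B].
  by apply/pred0P => v /=; rewrite !inE; apply/negP; lia.
pose low (X : {set 'I_n}) := [set u in C | (#|nbrs G u :&: X|%:R < t)].
(* If [q] vertices of [C] each saw fewer than [t] vertices of [X], they and [X] would violate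
   [exp]. *)
have few (X : {set 'I_n}) : #|X| = q -> [disjoint X & C] ->
    (#|low X| < q)%N.
  move=> Xq dX; rewrite ltnNge; apply/negP => /subset_of_card[Y YC Yq].
  have YC' : Y \subset C by apply: subset_trans YC _; apply/subsetP => u; rewrite inE => /andP[].
  have := exp X Y Xq Yq; rewrite (disjointWr YC' dX) => /(_ isT).
  rewrite leNgt => /negP; apply.
  rewrite volC /vol natr_sum -Yq mulr_natl -sumr_const.
  apply: ltr_sum => [|u /(subsetP YC)]; last by rewrite inE => /andP[].
  have /card_gt0P[u uY] : (0 < #|Y|)%N by rewrite Yq.
  by apply/hasP; exists u; rewrite ?mem_index_enum.
pose D := [set u in C | (t <= #|nbrs G u :&: A|%:R) && (t <= #|nbrs G u :&: B|%:R)].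
(* Fewer than [2 * q] of the at least [3 * q] vertices of [C] are low for [A] or [B]. *)
have Dq : (q <= #|D|)%N.
  have h : C \subset D :|: (low A :|: low B).
    apply/subsetP => u; rewrite !inE => -> /=; rewrite !ltNge.
    by case: (t <= _); case: (t <= _).
  have {}h : (3 * q <= #|D| + (#|low A| + #|low B|))%N.
    apply: leq_trans Cq (leq_trans (subset_leq_card h) _).
    apply: leq_trans (leq_card_setU _ _) _; rewrite leq_add2l.
    exact: leq_card_setU.
  move: h (few A Aq dA) (few B Bq dB).
  by move: #|D| #|low A| #|low B| => x y z; lia.
apply: le_trans (_ : (\sum_(u in C) #|nbrs G u :&: A| * #|nbrs G u :&: B|)%N%:R <= _).
  rewrite natr_sum; apply: le_trans (_ : \sum_(u in D) t ^+ 2 <= _).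
    by rewrite sumr_const -[leRHS]mulr_natl ler_wpM2r ?exprn_ge0 // ler_nat.
  rewrite big_mkcond [leRHS]big_mkcond; apply: ler_sum => u _.
  rewrite [u \in D]inE; case: (u \in C) => //=; case: andP => [[tA tB]|_].
    by rewrite natrM expr2 ler_pM.
  by rewrite ler0n.
apply: le_trans (_ : (\sum_(v in B)
   #|[set w in A | [exists u in C, adj G v u && adj G u w]]| + c4_count G)%N%:R <= _).
  by rewrite ler_nat; apply: cherries_le.
rewrite natrD lerD2r natr_sum -Bq mulr_natl -sumr_const; apply: ler_sum => v vB.
(* Positions of [A] precede that of [v] and positions of [C] follow it, so these vertices lie at
   positions in [left_nbrs]. *)
apply: le_trans (sp (r v)); rewrite ler_nat.
rewrite -(card_imset _ (@perm_inj _ s^-1%g)).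
apply/subset_leq_card/subsetP => x /imsetP[w]; rewrite inE => /andP[wA].
case/exists_inP => u uC vuw {x}->; rewrite inE.
move: vB wA uC; rewrite !inE -/(r w) => vB wA uC.
apply/andP; split; first by lia.
by apply/existsP; exists (r u); rewrite !rK vuw andbT; lia.
Qed.

End LowerBound.

(** * Union bounds *)

Section UnionBounds.
Variables (R : realType) (n : nat).
Implicit Types (p z x : R) (A : pred (sgraph 'I_n)).

Lemma expRN_le (x : R) : 0 < x -> expR (- x) <= x^-1.
Proof.
move=> x0; rewrite expRN lef_pV2 ?posrE ?expR_gt0 //.
by apply: le_trans (expR_ge1Dx x); lra.
Qed.

Lemma sum_sets_const (s : nat) (c : R) :
  \sum_(S : {set 'I_n} | #|S| == s) c = 'C(n, s)%:R * c.
Proof.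
rewrite mulr_natl -[in RHS](card_ord n) -card_draws -sumr_const.
by apply: eq_bigl => S; rewrite inE.
Qed.

(** Union bound over the [s]-sets. Degrees above [B] give [B.+1 * s] ordered pairs, hence at least
    half as many edges. *)
Lemma gnp_high_degree p z s B A : 0 <= p <= 1 -> 1 <= z ->
  (forall G, A G -> exists2 S : {set 'I_n}, #|S| = s &
     forall v, v \in S -> (B < #|nbrs G v|)%N) ->
  gnp_prob p A <=
  'C(n, s)%:R * (expR (p * (s * n)%:R * (z - 1)) / z ^+ uphalf (B.+1 * s)).
Proof.
move=> p01 z1 AS.
apply: le_trans (gnp_union (P := fun S : {set 'I_n} => #|S| == s)
  (B := fun S G => [forall v in S, (B < #|nbrs G v|)%N]) p01 _) _.
  by move=> G /AS[S Ss SB]; exists S; [rewrite Ss | apply/forall_inP].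
rewrite -sum_sets_const; apply: ler_sum => S /eqP Ss.
apply: gnp_upper_tail (pair_edges_card2 (D := setX S [set: 'I_n])) _ _ => //.
  rewrite ler_nat; apply: leq_trans (card_pair_edges _) _.
  by rewrite cardsX Ss cardsT card_ord.
move=> G /forall_inP SB.
have : (B.+1 * s <= vol G S [set: 'I_n])%N.
  rewrite mulnC -Ss -sum_nat_const; apply: leq_sum => v vS.
  by rewrite setIT; apply: SB.
by have := vol_le_edges G S [set: 'I_n]; lia.
Qed.

Lemma gnp_dense_set p z k m A : 0 <= p <= 1 -> 1 <= z ->
  (forall G, A G -> exists2 W : {set 'I_n}, #|W| = k & (2 * m <= vol G W W)%N) ->
  gnp_prob p A <=
  'C(n, k)%:R * (expR (p * (k * k)%:R * (z - 1)) / z ^+ m).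
Proof.
move=> p01 z1 AW.
apply: le_trans (gnp_union (P := fun S : {set 'I_n} => #|S| == k)
  (B := fun W G => (2 * m <= vol G W W)%N) p01 _) _.
  by move=> G /AW[W Wk Wm]; exists W => //; rewrite Wk.
rewrite -sum_sets_const; apply: ler_sum => W /eqP Wk.
apply: gnp_upper_tail (pair_edges_card2 (D := setX W W)) _ _ => //.
  by rewrite ler_nat; apply: leq_trans (card_pair_edges _) _; rewrite cardsX Wk.
by move=> G Wm; have := leq_trans Wm (vol_le_edges G W W); rewrite leq_pmul2l.
Qed.

(** Union bound over at most [4^n] pairs of sets. This crude count is affordable, as for [q] of
    order [n] and large [d] the exponent beats it. *)
Lemma gnp_sparse_pair p x q A : 0 <= p <= 1 ->
  (forall G, A G -> exists X Y : {set 'I_n},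
     [/\ #|X| = q, #|Y| = q, [disjoint X & Y] & (vol G X Y)%:R <= x]) ->
  gnp_prob p A <= (2 ^ n * 2 ^ n)%:R * expR (x - p * (q * q)%:R / 2).
Proof.
move=> p01 AXY.
apply: le_trans (gnp_union
  (P := fun Z : {set 'I_n} * {set 'I_n} =>
     [&& #|Z.1| == q, #|Z.2| == q & [disjoint Z.1 & Z.2]])
  (B := fun Z G => (vol G Z.1 Z.2)%:R <= x) p01 _) _.
  move=> G /AXY[X [Y [Xq Yq dXY hv]]]; exists (X, Y) => //=.
  by rewrite Xq Yq !eqxx.
apply: le_trans (_ : \sum_(Z : {set 'I_n} * {set 'I_n})
  expR (x - p * (q * q)%:R / 2) <= _).
  rewrite big_mkcond; apply: ler_sum => -[X Y] _ /=.
  case: and3P => [[/eqP Xq /eqP Yq dXY]|_]; last exact: expR_ge0.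
  apply: gnp_lower_tail (pair_edges_card2 (D := setX X Y)) _ _ => //.
    by rewrite card_pair_edges_disjoint // Xq Yq.
  by move=> G; apply: le_trans; rewrite ler_nat edges_le_vol.
rewrite sumr_const card_prod.
have -> : #|{: {set 'I_n}}| = (2 ^ n)%N.
  by rewrite -cardsT -powersetT card_powerset cardsT card_ord.
by rewrite mulr_natl.
Qed.

Lemma gnp_no_edge p A : 0 <= p <= 1 ->
  (forall G, A G -> edges G = set0) ->
  gnp_prob p A <= expR (- (p * 'C(n, 2)%:R / 2)).
Proof.
move=> p01 A0.
have := @gnp_lower_tail R n p [set e : {set 'I_n} | #|e| == 2%N] ('C(n, 2)%:R) 0 A p01.
rewrite sub0r; apply.
- by move=> e; rewrite inE => /eqP.
- by rewrite card_draws card_ord.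
- by move=> G /A0 ->; rewrite set0I cards0.
Qed.

(** Each of the [n^4] quadruples either cannot occur or needs four distinct edges. The factor [e^4]
    is the loss of bounding [p^4] through [gnp_upper_tail]. *)
Lemma gnp_c4_mean p : 0 < p <= 1 ->
  \sum_(G : sgraph 'I_n) gnp_mass p G * (c4_count G)%:R <=
  expR 4 * (p * n%:R) ^+ 4.
Proof.
move=> /andP[p0 p1]; have p01 : 0 <= p <= 1 by rewrite (ltW p0).
pose P (v w u u' : 'I_n) (G : sgraph 'I_n) :=
  [&& v != w, u != u', adj G v u, adj G u w, adj G v u' & adj G u' w].
have -> : \sum_(G : sgraph 'I_n) gnp_mass p G * (c4_count G)%:R =
    \sum_v \sum_w \sum_u \sum_u' gnp_prob p (P v w u u').
  under eq_bigr do rewrite /c4_count natr_sum mulr_sumr.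
  rewrite exchange_big; apply: eq_bigr => v _ /=.
  under eq_bigr do rewrite natr_sum mulr_sumr.
  rewrite exchange_big; apply: eq_bigr => w _ /=.
  under eq_bigr do rewrite natr_sum mulr_sumr.
  rewrite exchange_big; apply: eq_bigr => u _ /=.
  under eq_bigr do rewrite natr_sum mulr_sumr.
  rewrite exchange_big; apply: eq_bigr => u' _ /=.
  rewrite /gnp_prob [RHS]big_mkcond; apply: eq_bigr => G _.
  by rewrite -/(P v w u u' G); case: (P _ _ _ _ _); rewrite ?mulr1 ?mulr0.
have bound v w u u' : gnp_prob p (P v w u u') <= expR 4 * p ^+ 4.
  have [/and5P[vw uu' vu uw /andP[vu' u'w]]|triv] :=
      boolP [&& v != w, u != u', v != u, u != w, v != u' & u' != w]; last first.
    apply: le_trans (_ : 0 <= _).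
      rewrite /gnp_prob big1 // => G /and5P[vw uu' /adj_neq vu /adj_neq uw].
      case/andP => /adj_neq vu' /adj_neq u'w; move: triv.
      by rewrite vw uu' vu uw vu' u'w.
    by rewrite mulr_ge0 ?expR_ge0 ?exprn_ge0 // ltW.
  pose F := [set e in [:: [set v; u]; [set u; w]; [set v; u']; [set u'; w]]].
  have F4 : #|F| = 4%N.
    have ne (a b c e : 'I_n) : a != c -> a != e -> [set a; b] != [set c; e].
      move=> ac ae; apply/eqP => /set2_eq[] [h _]; subst; move: ac ae;
      by rewrite eqxx.
    rewrite cardsE; apply/card_uniqP; rewrite /= !inE !negb_or.
    have uv : u != v by rewrite eq_sym.
    rewrite (ne v u u w) // (ne v u u' w) // (ne u w v u') // (ne u w u' w) //.
    by rewrite (ne v u' u' w) // (setUC [set v] [set u]) (ne u v v u').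
  (* With [z = 1 / p] the exponential bound is [p ^ 4] up to a constant. *)
  apply: le_trans (gnp_upper_tail (z := p^-1) (F := F) (m := 4) (k := 4) _ _ _ _ _) _ => //.
  - by rewrite invf_ge1.
  - by move=> e; rewrite !inE => /or4P[] /eqP ->; rewrite cards2 ?vu ?uw ?vu' ?u'w.
  - by rewrite F4.
  - move=> G /and5P[_ _ avu auw /andP[avu' au'w]].
    rewrite -F4; apply/subset_leq_card/subsetP => e eF; rewrite inE eF andbT.
    by move: eF; rewrite !inE => /or4P[] /eqP ->.
  rewrite exprVn invrK ler_pM2r ?exprn_gt0 // ler_expR.
  have -> : p * 4 * (p^-1 - 1) = 4 - 4 * p by field; apply: lt0r_neq0.
  lra.
rewrite exprMn mulrA [leRHS]mulrC.
have -> : n%:R ^+ 4 * (expR 4 * p ^+ 4) =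
    \sum_(v < n) \sum_(w < n) \sum_(u < n) \sum_(u' < n) (expR 4 * p ^+ 4).
  by rewrite !sumr_const !card_ord -!mulrnA -natrX mulr_natl; congr (_ *+ _); lia.
by do 4! (apply: ler_sum => ? _).
Qed.

End UnionBounds.

(** * Estimates for p = d / n *)

Section Estimates.
Variable R : realType.
Implicit Types d : R.

(* [expR (- 10) * n / d ^ 3] is the size below which vertex sets are sparse:
   [dense_set_estimate] needs [expR 17 * d ^ 6 * (s / n) ^ 2 <= 1 / 4]. The degree
   threshold [(expR 2 + 15) * d] makes fewer vertices than that exceed it. *)
Lemma high_degree_estimate d (n s B : nat) : 1 <= d -> (0 < n)%N ->
  expR (- 10) * n%:R / d ^+ 3 < s%:R -> (expR 2 + 15) * d < B.+1%:R ->
  'C(n, s)%:R * (expR (d / n%:R * (s * n)%:R * (expR 2 - 1))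
                 / expR 2 ^+ uphalf (B.+1 * s)) <= expR 10 * d ^+ 3 / n%:R.
Proof.
move=> d1 n0 ns dB; have d0 : 0 < d by lra.
have nR : 0 < n%:R :> R by rewrite ltr0n.
set x : R := expR (- 10) / d ^+ 3.
have x0 : 0 < x by rewrite divr_gt0 ?expR_gt0 ?exprn_gt0.
have xn : x * n%:R < s%:R by move: ns; rewrite /x mulrAC.
have s0 : 0 < s%:R :> R by apply: lt_trans xn; rewrite mulr_gt0.
have xV : x^-1 = expR 10 * d ^+ 3 by rewrite /x invf_div -expRN opprK mulrC.
(* [d <= e^d] makes the exponent linear in [d], so the degree threshold can absorb it. *)
have xle : x^-1 <= expR (3 * d + 10).
  rewrite xV (expRD (3 * d)) mulrC ler_pM2r ?expR_gt0 // expRM_natl lerXn2r ?nnegrE ?expR_ge0 //.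
    exact: ltW.
  by apply: le_trans (expR_ge1Dx d); lra.
have h1 : 'C(n, s)%:R <= expR (s%:R + s%:R * (3 * d + 10)).
  apply: le_trans (bin_le_exp n s x0) _; rewrite expRD.
  apply: ler_pM; rewrite ?expR_ge0 ?invr_ge0 ?exprn_ge0 ?ler_expR ?(ltW x0) ?(ltW xn) //.
  by rewrite -exprVn expRM_natl lerXn2r ?nnegrE ?expR_ge0 ?invr_ge0 ?(ltW x0).
have h2 : expR (d / n%:R * (s * n)%:R * (expR 2 - 1)) / expR 2 ^+ uphalf (B.+1 * s)
    <= expR (d * s%:R * (expR 2 - 1) - (expR 2 + 15) * d * s%:R).
  rewrite -expRM_natl -expRN -expRD ler_expR; apply: lerB.
    by rewrite natrM (mulrC s%:R) mulrA divfK ?gt_eqF.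
  apply: le_trans (_ : (B.+1 * s)%:R <= _).
    by rewrite natrM; apply: ler_wpM2r; exact: ltW.
  by rewrite -natrM ler_nat; move: (B.+1 * s)%N; clear; lia.
apply: le_trans (_ : expR (s%:R + s%:R * (3 * d + 10)) *
    expR (d * s%:R * (expR 2 - 1) - (expR 2 + 15) * d * s%:R) <= _).
  by apply: ler_pM => //; rewrite divr_ge0 ?expR_ge0 ?exprn_ge0 ?expR_ge0.
(* The exponent equals [s (11 - 13 d)], which is at most [- s] since [1 <= d]. *)
rewrite -expRD; apply: le_trans (_ : expR (- s%:R) <= _).
  by rewrite ler_expR; nra.
apply: le_trans (expRN_le s0) _; rewrite -xV -invfM.
by rewrite lef_pV2 ?posrE ?(mulr_gt0 x0 nR) ?(ltW xn).
Qed.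

(** With [y = s / n] and base [z = 1 / (d y)] everything collapses to [b^s] for
    [b = e^17 d^6 y^2 <= 1 / 4]. The final bound is free of [s], so summing over up to [n] sizes
    costs [O(1 / n)]. *)
Lemma dense_set_estimate d (n s : nat) : 1 <= d -> (0 < n)%N -> (0 < s)%N ->
  s%:R <= expR (- 10) * n%:R / d ^+ 3 ->
  'C(n, 4 * s)%:R * (expR (d / n%:R * ((4 * s) * (4 * s))%:R *
       (n%:R / (d * s%:R) - 1)) / (n%:R / (d * s%:R)) ^+ (6 * s))
   <= expR 17 * d ^+ 6 / n%:R ^+ 2.
Proof.
move=> d1 n0 s0 sn; have d0 : 0 < d by lra.
have nR : 0 < n%:R :> R by rewrite ltr0n.
have sR : 0 < s%:R :> R by rewrite ltr0n.
set y : R := s%:R / n%:R.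
have y0 : 0 < y by rewrite divr_gt0.
have zE : n%:R / (d * s%:R) = (d * y)^-1.
  by rewrite /y; field; rewrite !gt_eqF.
have h1 : 'C(n, 4 * s)%:R <= expR s%:R * (y^-1) ^+ (4 * s).
  have := bin_le_exp n (4 * s) y0.
  by rewrite {1}/y divfK ?gt_eqF // exprVn.
have h2 : expR (d / n%:R * ((4 * s) * (4 * s))%:R * (n%:R / (d * s%:R) - 1))
    <= expR (16 * s%:R).
  rewrite ler_expR !natrM mulrBr mulr1.
  have -> : d / n%:R * (4 * s%:R * (4 * s%:R)) * (n%:R / (d * s%:R)) = 16 * s%:R.
    by field; rewrite !gt_eqF.
  by rewrite gerBl !mulr_ge0 ?invr_ge0 // ltW.
pose b := expR 17 * d ^+ 6 * y ^+ 2.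
have b0 : 0 <= b by rewrite !mulr_ge0 ?expR_ge0 ?exprn_ge0 // ltW.
have e3 : expR (- 3) <= 1 / 4 :> R.
  rewrite expRN div1r lef_pV2 ?posrE ?expR_gt0 //.
  by apply: le_trans (expR_ge1Dx 3); lra.
have yle : y <= expR (- 10) / d ^+ 3.
  by rewrite /y ler_pdivrMr // mulrAC.
have b4 : b <= 1 / 4.
  apply: le_trans e3; rewrite /b.
  apply: le_trans (_ : expR 17 * d ^+ 6 * (expR (- 10) / d ^+ 3) ^+ 2 <= _).
    apply: ler_wpM2l; first by rewrite mulr_ge0 ?expR_ge0 ?exprn_ge0 // ltW.
    apply: lerXn2r => //; rewrite nnegrE; first exact: ltW.
    by rewrite divr_ge0 ?expR_ge0 ?exprn_ge0 // ltW.
  have -> : expR 17 * d ^+ 6 * (expR (- 10) / d ^+ 3) ^+ 2 =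
            expR 17 * expR (- 10) ^+ 2 :> R by field; rewrite gt_eqF.
  rewrite -expRM_natl -expRD ler_expR; lra.
have step : 'C(n, 4 * s)%:R * (expR (d / n%:R * ((4 * s) * (4 * s))%:R *
       (n%:R / (d * s%:R) - 1)) / (n%:R / (d * s%:R)) ^+ (6 * s)) <= b ^+ s.
  apply: le_trans (_ : (expR s%:R * (y^-1) ^+ (4 * s)) *
     (expR (16 * s%:R) * (d * y) ^+ (6 * s)) <= _).
    rewrite -exprVn zE invrK -zE; apply: ler_pM => //.
      by rewrite mulr_ge0 ?expR_ge0 ?exprn_ge0 ?mulr_ge0 ?(ltW d0) ?(ltW y0).
    by rewrite ler_wpM2r ?exprn_ge0 ?mulr_ge0 ?(ltW d0) ?(ltW y0).
  rewrite mulrACA -expRD.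
  have -> : s%:R + 16 * s%:R = s%:R * 17 :> R by ring.
  rewrite expRM_natl !exprM -!exprMn /b.
  have -> : expR 17 * (y^-1 ^+ 4 * (d * y) ^+ 6) = expR 17 * d ^+ 6 * y ^+ 2.
    by field; rewrite gt_eqF.
  by [].
apply: le_trans step _.
have [k sk] : exists k, s = k.+1 by exists s.-1; rewrite prednK.
(* The factor [s^2] inside [b] is absorbed by the remaining [(1 / 4)^(s - 1)]. *)
have s2 : s%:R <= 2 ^+ k :> R.
  by rewrite sk -natrX ler_nat; apply: ltn_expl.
rewrite sk exprS; apply: le_trans (_ : b * (1 / 4) ^+ k <= _).
  by apply: ler_wpM2l => //; apply: lerXn2r; rewrite ?nnegrE //; lra.
have -> : b = expR 17 * d ^+ 6 / n%:R ^+ 2 * s%:R ^+ 2.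
  by rewrite /b /y; field; rewrite gt_eqF.
rewrite -mulrA -[leRHS]mulr1; apply: ler_wpM2l.
  by rewrite divr_ge0 ?mulr_ge0 ?expR_ge0 ?exprn_ge0 // ltW.
have -> : (1 / 4) ^+ k = ((2 ^+ k) ^+ 2)^-1 :> R.
  by rewrite -exprM mulnC exprM div1r exprVn; congr (_ ^+ _)^-1; ring.
rewrite ler_pdivrMr ?exprn_gt0 // mul1r; apply: lerXn2r => //.
  by rewrite nnegrE ltW.
by rewrite nnegrE exprn_ge0.
Qed.

Lemma gnp_not_arrangeable d (n : nat) : 1 <= d -> d <= n%:R ->
  gnp_prob (d / n%:R) (fun G : sgraph 'I_n =>
     ~~ arrangeable ((expR 2 + 15) ^+ 2 * d ^+ 2) G)
  <= (expR 10 * d ^+ 3 + expR 17 * d ^+ 6) / n%:R.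
Proof.
move=> d1 dn; have d0 : 0 < d by lra.
have nR : 0 < n%:R :> R by lra.
have n0 : (0 < n)%N by rewrite -(ltr0n R).
have p01 : 0 <= d / n%:R <= 1.
  by rewrite divr_ge0 ?(ltW d0) //= ler_pdivrMr // mul1r.
pose K : R := expR 2 + 15.
have K0 : 15 <= K by rewrite lerDr expR_ge0.
pose eps : R := expR (- 10) * n%:R / d ^+ 3.
have eps0 : 0 <= eps by rewrite !mulr_ge0 ?expR_ge0 ?invr_ge0 ?exprn_ge0 // ltW.
have d31 : 1 <= d ^+ 3 by rewrite exprn_ege1.
have eps_n : eps * 11 <= n%:R.
  rewrite /eps mulrAC ler_pdivrMr ?exprn_gt0 //.
  have : expR (- 10) * 11 <= 1 :> R.
    rewrite expRN mulrC ler_pdivrMr ?expR_gt0 // mul1r.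
    by apply: le_trans (expR_ge1Dx 10); lra.
  by have := expR_ge0 (- 10 : R); nra.
pose s0 := Num.truncn eps; pose B := Num.truncn (K * d).
have /andP[s0le s0lt] : s0%:R <= eps < s0.+1%:R by rewrite truncn_itv.
have /andP[Ble Blt] : B%:R <= K * d < B.+1%:R by rewrite truncn_itv // mulr_ge0 //; lra.
have s0n : (11 * s0 <= n)%N.
  by rewrite -(ler_nat R) natrM; lra.
have B12 : (12 <= B)%N by rewrite -ltnS -(ltr_nat R); apply: le_lt_trans Blt; nra.
(* Index 0 stands for too many vertices of high degree; an index [i > 0] stands for a dense set of
   size [4 * i]. *)
pose bad (i : 'I_s0.+1) (G : sgraph 'I_n) : bool :=
  if i == 0%N :> nat
  then [exists S : {set 'I_n}, (#|S| == s0.+1) &&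
          [forall v in S, (B < #|nbrs G v|)%N]]
  else [exists W : {set 'I_n}, (#|W| == 4 * i)%N && (2 * (6 * i) <= vol G W W)%N].
apply: le_trans (gnp_union (P := xpredT) (B := bad) p01 _) _.
  move=> G; apply: contraNP => nbad.
  have {}nbad i : ~~ bad i G by apply/negP => h; apply: nbad; exists i.
  apply: (arrangeable_of_greedy (P := (B * B)%N)).
    rewrite natrM -exprMn expr2; apply: ler_pM => //.
  apply: (greedy_step (s0 := s0) B12).
  - by rewrite card_ord (leq_trans _ s0n) // leq_mul2r orbT.
  - move=> S sS; apply/exists_inP; apply: contraNT (nbad ord0) => hS.
    have [S' S'S S's] := subset_of_card sS.
    apply/existsP; exists S'; rewrite S's eqxx; apply/forall_inP => v vS'.
    move: hS; rewrite negb_exists_in => /forall_inP/(_ v (subsetP S'S v vS')).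
    by rewrite -ltnNge.
  - move=> W s /andP[s_gt0 ss0] Ws; rewrite ltnNge.
    have := nbad (Ordinal (ss0 : (s < s0.+1)%N)); rewrite /bad /=.
    rewrite eqn0Ngt s_gt0 /=; apply: contra => h.
    by apply/existsP; exists W; rewrite Ws eqxx /= mulnA.
rewrite big_ord_recl mulrDl; apply: lerD.
  apply: le_trans (high_degree_estimate d1 n0 s0lt Blt).
  apply: gnp_high_degree => //; first by rewrite -[leLHS]expR0 ler_expR.
  by move=> G /existsP[S /andP[/eqP Ss /forall_inP h]]; exists S.
apply: le_trans (_ : \sum_(i < s0) (expR 17 * d ^+ 6 / n%:R ^+ 2) <= _).
  apply: ler_sum => i _; rewrite /bad /= /bump /=.
  set s := (1 + i)%N.
  have ss : s%:R <= eps.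
    by apply: le_trans s0le; rewrite ler_nat /s add1n.
  apply: le_trans (dense_set_estimate d1 n0 (isT : (0 < s)%N) ss).
  apply: gnp_dense_set => //.
    rewrite ler_pdivlMr ?mul1r ?mulr_gt0 //.
    apply: le_trans (_ : d * eps <= _); first by rewrite ler_pM2l.
    have -> : d * eps = expR (- 10) * n%:R / d ^+ 2 by rewrite /eps; field; rewrite gt_eqF.
    rewrite ler_pdivrMr ?exprn_gt0 //.
    have : expR (- 10) <= 1 :> R by rewrite -[leRHS]expR0 ler_expR; lra.
    have : 1 <= d ^+ 2 by rewrite exprn_ege1.
    by have := expR_ge0 (- 10 : R); nra.
  by move=> G /existsP[W /andP[/eqP Ws h]]; exists W.
rewrite sumr_const card_ord -[leLHS]mulr_natl.
have c0 : 0 <= expR 17 * d ^+ 6 :> R by rewrite mulr_ge0 ?expR_ge0 ?exprn_ge0 // ltW.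
have -> : expR 17 * d ^+ 6 / n%:R = n%:R * (expR 17 * d ^+ 6 / n%:R ^+ 2).
  by field; rewrite gt_eqF.
apply: ler_wpM2r; first by rewrite divr_ge0 ?exprn_ge0.
by rewrite ler_nat (leq_trans _ s0n) // leq_pmull.
Qed.

Lemma gnp_arrangeable c d (n : nat) :
  c * 500 = 1 -> 1 <= d -> d <= n%:R -> (30 <= n)%N ->
  gnp_prob (d / n%:R) (fun G : sgraph 'I_n =>
     arrangeable (c ^+ 2 * d ^+ 2) G)
  <= (9 + expR 4 * d ^+ 4) / n%:R.
Proof.
move=> c500 d1 dn n30.
(* [30 <= n] makes the rounding of [n / 5] harmless for [n <= 6 * q]. *)
have [q [q0 q5 q6]] : exists q, [/\ (0 < q)%N, (5 * q <= n)%N & (n <= 6 * q)%N].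
  by exists (n %/ 5)%N; clear -n30; split; lia.
have d0 : 0 < d by lra.
have c0 : 0 < c by lra.
pose w := c * d.
have cdw : c * d = w by [].
have dw : d = 500 * w by rewrite /w mulrA (mulrC 500) c500 mul1r.
clearbody w.
have nR : 0 < n%:R :> R by lra.
have n30R : 30 <= n%:R :> R by rewrite (ler_nat R 30).
have p01' : 0 < d / n%:R <= 1.
  by rewrite divr_gt0 //= ler_pdivrMr // mul1r.
have p01 : 0 <= d / n%:R <= 1 by have /andP[/ltW -> ->] := p01'.
have c4_ge0 : 0 <= expR 4 * d ^+ 4 :> R.
  by rewrite mulr_ge0 ?expR_ge0 ?exprn_ge0 // ltW.
have [dlt|dge] := ltP d 500.
  (* The bound is below 1, so a single edge suffices. *)
  apply: le_trans (gnp_no_edge p01 _) _.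
    move=> G; apply: contraTeq => /set0Pn[e eG].
    have /eqP/cards2P[x [y [xy exy]]] := edge_card2 eG.
    apply: (not_arrangeable_edge (x := x) (y := y)); first by rewrite /adj -exy.
    by rewrite -exprMn cdw; apply: exprn_ilt1; lra.
  (* The exponent [d (n - 1) / 4] is at least [n / 9]; this is the source of the 9 in the
     conclusion. *)
  apply: le_trans (_ : expR (- (n%:R / 9)) <= _).
    rewrite ler_expR lerN2.
    have -> : 'C(n, 2)%:R = n%:R * (n%:R - 1) / 2 :> R.
      apply: (canRL (mulfK _)) => //; rewrite -[2]/(2`!%:R) -natrM bin_ffact.
      by rewrite !ffactnS ffactn0 muln1 natrM -subn1 natrB // (leq_trans _ n30).
    have -> : d / n%:R * (n%:R * (n%:R - 1) / 2) / 2 = d * (n%:R - 1) / 4.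
      by field; rewrite gt_eqF.
    nra.
  apply: le_trans (expRN_le _) _; first by rewrite divr_gt0.
  by rewrite invf_div ler_pM2r ?invr_gt0 //; lra.
have qR : n%:R <= 6 * q%:R :> R by rewrite -natrM ler_nat.
(* Two disjoint [q]-sets have on average at least [q * (d / 6)] edges between them; [t] takes a
   quarter of this, below the half that [gnp_lower_tail] subtracts. *)
pose t := d / 24.
pose bad (b : bool) (G : sgraph 'I_n) : bool :=
  if b then [exists Z : {set 'I_n} * {set 'I_n},
      [&& #|Z.1| == q, #|Z.2| == q, [disjoint Z.1 & Z.2] &
         (vol G Z.1 Z.2)%:R <= q%:R * t]]
  else (n <= c4_count G)%N.
apply: le_trans (gnp_union (P := xpredT) (B := bad) p01 _) _.
  move=> G aG; have [c4|c4] := leqP n (c4_count G); first by exists false.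
  exists true => //; apply: contraT => nbad; exfalso.
  have exp (X Y : {set 'I_n}) : #|X| = q -> #|Y| = q -> [disjoint X & Y] ->
      q%:R * t <= (vol G X Y)%:R.
    move=> Xq Yq dXY; rewrite leNgt; apply: contraNN nbad => h.
    by apply/existsP; exists (X, Y); rewrite /= Xq Yq !eqxx dXY (ltW h).
  have t0 : 0 <= t by rewrite /t; lra.
  have c4R : (c4_count G)%:R < n%:R :> R by rewrite ltr_nat.
  have qR0 : 0 < q%:R :> R by rewrite ltr0n.
  have w1 : 1 <= w by lra.
  have w21 : 1 <= w ^+ 2 by rewrite exprn_ege1.
  have tw : 20 * w <= t by rewrite /t; lra.
  have t2 : 400 * w ^+ 2 <= t ^+ 2.
    have -> : 400 * w ^+ 2 = (20 * w) ^+ 2 by ring.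
    by apply: lerXn2r; rewrite ?nnegrE //; lra.
  (* Contradiction: [400 * q * w^2] would be at most [q * w^2 + n], while
     [n <= 6 * q <= 6 * q * w^2]. *)
  have := arrangeable_cherries q0 q5 t0 exp aG; rewrite -exprMn cdw.
  have : q%:R <= q%:R * w ^+ 2 by rewrite ler_peMr // ltW.
  have : q%:R * (400 * w ^+ 2) <= q%:R * t ^+ 2 by rewrite ler_pM2l.
  lra.
rewrite big_bool /= mulrDl; apply: lerD.
  apply: le_trans (gnp_sparse_pair (q := q) (x := q%:R * t) p01 _) _.
    by move=> G /existsP[[X Y] /and4P[/eqP Xq /eqP Yq dXY h]]; exists X, Y.
  have qR0 : 0 < q%:R :> R by rewrite ltr0n.
  (* [4^n <= e^(2 n)], whereas the tail exponent is at most [- q d / 24 <= - 3 n] by [500 <= d] and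
     [n <= 6 * q]. *)
  apply: le_trans (_ : expR (n%:R * 2) * expR (- (n%:R * 3)) <= _).
    apply: ler_pM; rewrite ?expR_ge0 //.
      rewrite -expnMn natrX expRM_natl lerXn2r ?nnegrE ?expR_ge0 //.
      have -> : 2 = 2%:R * 1 :> R by ring.
      rewrite expRM_natl natrM -expr2 lerXn2r ?nnegrE ?expR_ge0 //.
      by apply: le_trans (expR_ge1Dx 1).
    rewrite ler_expR /t.
    have : d * q%:R / 6 <= d / n%:R * (q * q)%:R.
      have -> : d / n%:R * (q * q)%:R = d * q%:R * (q%:R / n%:R).
        by rewrite natrM; ring.
      apply: ler_wpM2l; first by rewrite mulr_ge0 ?(ltW d0) ?(ltW qR0).
      by rewrite ler_pdivlMr //; lra.
    have : 500 * q%:R <= d * q%:R by rewrite ler_pM2r.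
    lra.
  rewrite -expRD; apply: le_trans (_ : expR (- n%:R) <= _).
    by rewrite ler_expR; lra.
  apply: le_trans (expRN_le nR) _.
  by rewrite -[leLHS]mul1r ler_pM2r ?invr_gt0 //; lra.
(* The mean of [c4_count] is at most [e^4 d^4], independent of [n], so reaching [n] has probability
   [O(1 / n)]. *)
apply: le_trans (gnp_markov (f := fun G => (c4_count G)%:R / n%:R) p01 _ _) _.
- by move=> G; rewrite divr_ge0.
- by move=> G nc; rewrite ler_pdivlMr // mul1r ler_nat.
under eq_bigr do rewrite mulrA.
rewrite -mulr_suml ler_pM2r ?invr_gt0 //.
by apply: le_trans (gnp_c4_mean n p01') _; rewrite divfK ?gt_eqF.
Qed.

End Estimates.

(** * Convergence of the probability to 1 *)

Local Open Scope classical_set_scope.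

Theorem theorem1p2 (R : realType) :
  exists c1 c2 : R, [/\ 0 < c2, c2 < c1 &
    forall d : R, 1 <= d ->
      gnp_prob (d / n%:R)
        (fun G : sgraph 'I_n => arrangeable (c1 * d ^+ 2) G
                                && ~~ arrangeable (c2 * d ^+ 2) G)
        @[n --> \oo] --> (1 : R)].
Proof.
have [c c500] : exists c : R, c * 500 = 1 by exists (500^-1); rewrite mulVf.
have c0 : 0 < c by lra.
have K0 : 15 <= expR 2 + 15 :> R by rewrite lerDr expR_ge0.
exists ((expR 2 + 15) ^+ 2), (c ^+ 2); split; first exact: exprn_gt0.
  by rewrite ltrXn2r //; lra.
move=> d d1; set c1 := (expR 2 + 15) ^+ 2; set c2 := c ^+ 2.
have d0 : 0 < d by lra.
pose C := (expR 10 * d ^+ 3 + expR 17 * d ^+ 6) + (9 + expR 4 * d ^+ 4).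
have C0 : 0 <= C.
  by rewrite !addr_ge0 ?mulr_ge0 ?expR_ge0 ?exprn_ge0 // ltW.
(* The failure probability is at most [C / n]. Since [harmonic n] is [1 / (n + 1)], the factor 2
   pays for the shift. *)
apply: (@squeeze_cvgr _ _ _ _ (fun n => 1 - C * 2 * harmonic n) (fun=> 1)).
- exists (30 + Num.truncn d).+1 => // n /= dn.
  have n30 : (30 <= n)%N by apply: leq_trans (ltnW dn); exact: leq_addr.
  have n0 : (0 < n)%N by apply: leq_trans n30.
  have {}dn : d <= n%:R.
    have /andP[_ /ltW] := truncn_itv (ltW d0); move=> h; apply: le_trans h _.
    by rewrite ler_nat; apply: leq_trans dn; rewrite ltnS leq_addl.
  have nR : 0 < n%:R :> R by rewrite ltr0n.
  have p01 : 0 <= d / n%:R <= 1.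
    by rewrite divr_ge0 ?(ltW d0) //= ler_pdivrMr // mul1r.
  rewrite gnp_prob_predC gerBl gnp_prob_ge0 // andbT lerB //.
  pose bad (b : bool) (G : sgraph 'I_n) : bool :=
    if b then ~~ arrangeable (c1 * d ^+ 2) G else arrangeable (c2 * d ^+ 2) G.
  apply: le_trans (gnp_union (P := xpredT) (B := bad) p01 _) _.
    move=> G; rewrite negb_and negbK => /orP[h|h]; first by exists true.
    by exists false.
  rewrite big_bool /=; apply: le_trans (_ : C / n%:R <= _).
    rewrite mulrDl; apply: lerD; first exact: gnp_not_arrangeable.
    exact: gnp_arrangeable.
  rewrite -mulrA ler_wpM2l // /harmonic ler_pdivlMr ?ltr0n //.
  rewrite mulrC ler_pdivrMr // -natrM ler_nat.
  by rewrite mul2n -addnn -[n.+1]addn1 leq_add2l.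
- rewrite -[X in _ --> X]subr0 -[X in _ --> _ - X](mulr0 (C * 2)).
  by apply: cvgB; [exact: cvg_cst | apply: cvgMr; exact: cvg_harmonic].
- exact: cvg_cst.
Qed.
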